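(* Suppose that $\ell$ is an odd prime, let $t\ge2$ be an integer and let $m=(\ell-1)/2$. Then $$\mathrm{Prob}_\ell(X_t;\mu>0)\le\sum_{i=1}^{\lfloor t/\ell\rfloor}2^{i\ell}\binom{t}{i\ell}\sum_{a_1+\cdots+a_m=i}\frac{(i\ell)!}{(\ell^t-1)\prod_{j=1}^m(a_j\ell)!},$$ where the second sum runs over all tuples $(a_1,\dots,a_m)$ of non-negative integers with $a_1+\cdots+a_m=i$.
   Context: For $b\in\mathbb{Z}_\ell$ put $\binom{b}{n}=\frac{b(b-1)\cdots(b-n+1)}{n!}\in\mathbb{Z}_\ell$ and $(1+T)^b=\sum_{n\ge0}\binom{b}{n}T^n\in\mathbb{Z}_\ell[[T]]$. The bouquet $X_t$ is the multigraph with one vertex and $t$ undirected loops; a vector $\alpha=(\alpha_1,\dots,\alpha_t)\in\mathbb{Z}_\ell^t$ assigns the voltage $\alpha_j$ to the $j$-th loop. It is admissible if $\alpha\in\mathbb{Z}_\ell^t\setminus(\ell\mathbb{Z}_\ell)^t$. The characteristic series is $$f(T)=f_{X_t,\alpha}(T)=\sum_{j=1}^t\big(2-(1+T)^{\alpha_j}-(1+T)^{-\alpha_j}\big)\in\mathbb{Z}_\ell[[T]].$$ For admissible $\alpha$ it is nonzero, and it has zero constant term. By Weierstrass preparation write $f(T)=\ell^{\mu}g(T)u(T)$ with $\mu\in\mathbb{Z}_{\ge0}$, $g$ a distinguished polynomial (monic, all non-leading coefficients divisible by $\ell$) and $u\in\mathbb{Z}_\ell[[T]]^\times$. Then $\mu_\ell(X_t,\alpha):=\mu$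 and $\lambda_\ell(X_t,\alpha):=\deg g-1$. Let $\tau$ be the Haar measure on $\mathbb{Z}_\ell^t$ normalized by $\tau(\mathbb{Z}_\ell^t)=1$, so $\tau(\mathbb{Z}_\ell^t\setminus(\ell\mathbb{Z}_\ell)^t)=1-\ell^{-t}$. Define $$\mathrm{Prob}_\ell(X_t;\mu>0)=(1-\ell^{-t})^{-1}\,\tau\big(\{\alpha\in\mathbb{Z}_\ell^t\setminus(\ell\mathbb{Z}_\ell)^t:\mu_\ell(X_t,\alpha)>0\}\big).$$ *)

(* Defs.v *)
From HB Require Import structures.
From mathcomp Require Import all_boot all_order all_algebra.
From mathcomp Require Import all_classical all_reals all_analysis.

Set Implicit Arguments.
Unset Strict Implicit.
Unset Printing Implicit Defensive.

Import Order.TTheory GRing.Theory Num.Theory.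

Local Open Scope classical_set_scope.
Local Open Scope ring_scope.

(** The inverse limit of the rings Z/l^(n+1): [padic_res x n] is the residue of
    [x] modulo [l ^ n.+1]; indices start at [l ^ 1] because ['Z_1] is not the
    zero ring.  The type is only meant for [l] prime, but the ring structure
    does not need it. *)
Record padic (l : nat) := Padic {
  padic_res : forall n : nat, 'Z_(l ^ n.+1) ;
  padic_compat : forall n : nat,
    inZp (nat_of_ord (padic_res n.+1)) = padic_res n :> 'Z_(l ^ n.+1) }.

Section PadicRing.
Variable l : nat.
Implicit Types x y z : padic l.

Lemma padic_ext x y : (forall n, padic_res x n = padic_res y n) -> x = y.
Proof.
case: x y => x hx [y hy] /= xy.
have {}xy : x = y by apply: functional_extensionality_dep.
by case: _ / xy hy => hy; congr Padic; exact: Prop_irrelevance.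
Qed.

HB.instance Definition _ := gen_eqMixin (padic l).
HB.instance Definition _ := gen_choiceMixin (padic l).

Let dvd_Zp_trunc n :
  ((Zp_trunc (l ^ n.+1)).+2 %| (Zp_trunc (l ^ n.+2)).+2)%N.
Proof.
case: l => [|[|k]]; first by rewrite !exp0n.
  by rewrite !exp1n.
by rewrite !Zp_cast ?dvdn_exp2l// -{1}(expn0 k.+2) ltn_exp2l.
Qed.

Fact padic_zero_compat n :
  inZp (nat_of_ord (0 : 'Z_(l ^ n.+2))) = 0 :> 'Z_(l ^ n.+1).
Proof. by apply/val_inj; rewrite /= mod0n. Qed.
Definition padic_zero := Padic padic_zero_compat.

Fact padic_one_compat n :
  inZp (nat_of_ord (1 : 'Z_(l ^ n.+2))) = 1 :> 'Z_(l ^ n.+1).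
Proof. by apply/val_inj; rewrite /= modn_dvdm. Qed.
Definition padic_one := Padic padic_one_compat.

Fact padic_opp_compat x n :
  inZp (nat_of_ord (- padic_res x n.+1)) = - padic_res x n.
Proof.
rewrite -(padic_compat x n); apply/val_inj => /=.
set M := (Zp_trunc (l ^ n.+2)).+2; set m := (Zp_trunc (l ^ n.+1)).+2.
have dm : (m %| M)%N := dvd_Zp_trunc n.
rewrite modn_dvdm//; set a := nat_of_ord _.
have aM : (a < M)%N := ltn_ord (padic_res x n.+1).
have am : (a %% m <= m)%N by rewrite ltnW// ltn_mod.
apply/eqP; rewrite -(eqn_modDr (a %% m)) subnK// modnDmr subnK 1?ltnW//.
by rewrite (eqP dm) modnn.
Qed.
Definition padic_opp x := Padic (padic_opp_compat x).

Fact padic_add_compat x y n :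
  inZp (nat_of_ord (padic_res x n.+1 + padic_res y n.+1)) =
  padic_res x n + padic_res y n.
Proof.
rewrite -(padic_compat x n) -(padic_compat y n); apply/val_inj => /=.
by rewrite modn_dvdm// modnDm.
Qed.
Definition padic_add x y := Padic (padic_add_compat x y).

Fact padic_mul_compat x y n :
  inZp (nat_of_ord (padic_res x n.+1 * padic_res y n.+1)) =
  padic_res x n * padic_res y n.
Proof.
rewrite -(padic_compat x n) -(padic_compat y n); apply/val_inj => /=.
by rewrite modn_dvdm// modnMm.
Qed.
Definition padic_mul x y := Padic (padic_mul_compat x y).

Fact padic_addA : associative padic_add.
Proof. by move=> x y z; apply: padic_ext => n; exact: addrA. Qed.
Fact padic_addC : commutative padic_add.
Proof. by move=> x y; apply: padic_ext => n; exact: addrC. Qed.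
Fact padic_add0 : left_id padic_zero padic_add.
Proof. by move=> x; apply: padic_ext => n; exact: add0r. Qed.
Fact padic_addN : left_inverse padic_zero padic_opp padic_add.
Proof. by move=> x; apply: padic_ext => n; exact: addNr. Qed.
Fact padic_mulA : associative padic_mul.
Proof. by move=> x y z; apply: padic_ext => n; exact: mulrA. Qed.
Fact padic_mulC : commutative padic_mul.
Proof. by move=> x y; apply: padic_ext => n; exact: mulrC. Qed.
Fact padic_mul1 : left_id padic_one padic_mul.
Proof. by move=> x; apply: padic_ext => n; exact: mul1r. Qed.
Fact padic_mulDl : left_distributive padic_mul padic_add.
Proof. by move=> x y z; apply: padic_ext => n; exact: mulrDl. Qed.
Fact padic_oner_neq0 : padic_one != padic_zero.
Proof.
apply/eqP => /(congr1 (fun x => padic_res x 0)) /= /eqP.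
by rewrite (negbTE (oner_neq0 _)).
Qed.

HB.instance Definition _ := GRing.isZmodule.Build (padic l)
  padic_addA padic_addC padic_add0 padic_addN.
HB.instance Definition _ := GRing.Zmodule_isComNzRing.Build (padic l)
  padic_mulA padic_mulC padic_mul1 padic_mulDl padic_oner_neq0.

End PadicRing.

Section PadicTopology.
Variable l : nat.

Definition padic_open (U : set (padic l)) := forall x, U x ->
  exists n, forall y, padic_res y n = padic_res x n -> U y.

Let padic_res_le (x y : padic l) n m : (n <= m)%N ->
  padic_res y m = padic_res x m -> padic_res y n = padic_res x n.
Proof.
elim: m => [|m IHm]; first by rewrite leqn0 => /eqP ->.
rewrite leq_eqVlt => /predU1P[-> //|/IHm {}IHm yx]; apply: IHm.
by rewrite -(padic_compat y) -(padic_compat x) yx.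
Qed.

Fact padic_openT : padic_open setT.
Proof. by move=> x _; exists 0%N. Qed.
Fact padic_openI : setI_closed padic_open.
Proof.
move=> U V oU oV x [/oU[n Un] /oV[m Vm]]; exists (maxn n m) => y yx.
split; [apply: Un|apply: Vm]; apply: padic_res_le yx.
  exact: leq_maxl.
exact: leq_maxr.
Qed.
Fact padic_open_bigU (I : Type) (F : I -> set (padic l)) :
  (forall i, padic_open (F i)) -> padic_open (\bigcup_i F i).
Proof.
by move=> oF x [i _ /oF[n Fn]]; exists n => y /Fn Fy; exists i.
Qed.

HB.instance Definition _ := isPointed.Build (padic l) 0.
HB.instance Definition _ := isOpenTopological.Build (padic l)
  padic_openT padic_openI padic_open_bigU.

End PadicTopology.

Record fps (R : comNzRingType) := Fps { fps_coef : nat -> R }.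

Section FpsRing.
Variable R : comNzRingType.
Implicit Types f g h : fps R.

Lemma fps_ext f g : fps_coef f =1 fps_coef g -> f = g.
Proof. by case: f g => f [g] /= /funext ->. Qed.

HB.instance Definition _ := gen_eqMixin (fps R).
HB.instance Definition _ := gen_choiceMixin (fps R).

Definition fps_of_poly (p : {poly R}) : fps R := Fps (fun n => p`_n).
Definition fps_opp f : fps R := Fps (fun n => - fps_coef f n).
Definition fps_add f g : fps R := Fps (fun n => fps_coef f n + fps_coef g n).
Definition fps_mul f g : fps R :=
  Fps (fun n => \sum_(i < n.+1) fps_coef f i * fps_coef g (n - i)%N).

Fact fps_addA : associative fps_add.
Proof. by move=> f g h; apply: fps_ext => n; exact: addrA. Qed.
Fact fps_addC : commutative fps_add.
Proof. by move=> f g; apply: fps_ext => n; exact: addrC. Qed.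
Fact fps_add0 : left_id (fps_of_poly 0) fps_add.
Proof. by move=> f; apply: fps_ext => n /=; rewrite coef0 add0r. Qed.
Fact fps_addN : left_inverse (fps_of_poly 0) fps_opp fps_add.
Proof. by move=> f; apply: fps_ext => n /=; rewrite coef0 addNr. Qed.

Let tr n f : {poly R} := \poly_(i < n.+1) fps_coef f i.

Let coef_tr n f k : (k <= n)%N -> (tr n f)`_k = fps_coef f k.
Proof. by move=> kn; rewrite coef_poly ltnS kn. Qed.

Let coef_trM n f g k : (k <= n)%N ->
  fps_coef (fps_mul f g) k = (tr n f * tr n g)`_k.
Proof.
move=> kn; rewrite coefM; apply: eq_bigr => i _.
have le_ik : (i <= k)%N := ltn_ord i.
rewrite (coef_tr f (leq_trans le_ik kn)).
by rewrite (coef_tr g (leq_trans (leq_subr i k) kn)).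
Qed.

Fact fps_mulC : commutative fps_mul.
Proof.
by move=> f g; apply: fps_ext => n; rewrite !(coef_trM _ _ (leqnn n)) mulrC.
Qed.
Fact fps_mulA : associative fps_mul.
Proof.
move=> f g h; apply: fps_ext => n.
transitivity ((tr n f * (tr n g * tr n h))`_n).
  rewrite coefM; apply: eq_bigr => i _.
  have le_in : (i <= n)%N := ltn_ord i.
  by rewrite (coef_tr f le_in) (coef_trM g h (leq_subr i n)).
rewrite mulrA coefM; apply: eq_bigr => i _.
have le_in : (i <= n)%N := ltn_ord i.
by rewrite (coef_trM f g le_in) (coef_tr h (leq_subr i n)).
Qed.
Fact fps_mul1 : left_id (fps_of_poly 1) fps_mul.
Proof.
move=> f; apply: fps_ext => n /=.
rewrite big_ord_recl /= coef1 mul1r subn0 big1 ?addr0// => i _.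
by rewrite coef1 mul0r.
Qed.
Fact fps_mulDl : left_distributive fps_mul fps_add.
Proof.
move=> f g h; apply: fps_ext => n /=.
by rewrite -big_split; apply: eq_bigr => i _; rewrite mulrDl.
Qed.
Fact fps_oner_neq0 : fps_of_poly 1 != fps_of_poly 0.
Proof.
apply/eqP => /(congr1 (fun f => fps_coef f 0)) /= /eqP.
by rewrite coef1 coef0 (negbTE (oner_neq0 _)).
Qed.

HB.instance Definition _ := GRing.isZmodule.Build (fps R)
  fps_addA fps_addC fps_add0 fps_addN.
HB.instance Definition _ := GRing.Zmodule_isComNzRing.Build (fps R)
  fps_mulA fps_mulC fps_mul1 fps_mulDl fps_oner_neq0.

Definition fps_is_unit f := exists g, f * g = 1.

End FpsRing.

Section Bouquet.
Variable l : nat.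

(** The quotient of [b (b - 1) ... (b - n + 1)] by [n!]; for [l] prime it
    exists and is unique in the l-adic integers, so [xget] never takes its
    default value. *)
Definition padic_binom (b : padic l) (n : nat) : padic l :=
  xget 0 [set c | n`!%:R * c = \prod_(i < n) (b - i%:R)].

Definition onePT_pow (b : padic l) : fps (padic l) := Fps (padic_binom b).

Definition bouquet_series t (alpha : 'rV[padic l]_t) : fps (padic l) :=
  \sum_(j < t) (2 - onePT_pow (alpha 0 j) - onePT_pow (- alpha 0 j)).

Definition padic_dvd (x : padic l) := exists y, x = l%:R * y.

Definition admissible t (alpha : 'rV[padic l]_t) :=
  exists j, ~ padic_dvd (alpha 0 j).

Definition distinguished (g : {poly padic l}) :=
  g \is monic /\ forall i, (i < (size g).-1)%N -> padic_dvd g`_i.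

Definition weierstrass (f : fps (padic l)) (mu : nat) (g : {poly padic l})
    (u : fps (padic l)) :=
  [/\ distinguished g, fps_is_unit u & f = l%:R ^+ mu * fps_of_poly g * u].

(** For [l] prime and [f] nonzero, Weierstrass preparation gives exactly one
    such exponent; the default value [0] is irrelevant otherwise. *)
Definition mu_fps (f : fps (padic l)) : nat :=
  xget 0%N [set mu | exists g u, weierstrass f mu g u].

Definition mu_bouquet t (alpha : 'rV[padic l]_t) := mu_fps (bouquet_series alpha).

End Bouquet.

Definition padic_borel (l t : nat) :=
  g_sigma_algebraType (@open 'rV[padic l]_t).

(** The normalization to total mass 1 is part of [probability]; the condition
    determines the measure on this compact group. *)
Definition is_haar (R : realType) (l t : nat)
    (tau : probability (padic_borel l t) R) :=
  forall (a : 'rV[padic l]_t) (A : set 'rV[padic l]_t),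
    measurable (A : set (padic_borel l t)) ->
    tau [set a + x | x in A] = tau A.

Definition Prob_mu_pos (R : realType) (l t : nat)
    (tau : probability (padic_borel l t) R) : \bar R :=
  (((1 - l%:R ^- t)^-1)%:E *
   tau [set alpha : 'rV[padic l]_t |
         admissible alpha /\ (0 < mu_bouquet alpha)%N])%E.

(* Main.v *)
(* The probability is in fact zero, while the bound is nonnegative.  By
   Weierstrass preparation, [mu] is positive exactly when the series [f_alpha] is
   nonzero with all its coefficients divisible by [l], which is a Borel condition
   on [alpha].  Fix [j] and let [S] be the set of such [alpha] with [alpha_j] a
   unit.  If both [alpha] and [alpha + s e_j] are in [S], with [s > 0] divisible
   by [l], then the difference of their series factors, with [b = alpha_j], as
   [(1 - (1 + T)^s) ((1 + T)^b - (1 + T)^(- b - s))].  The second factor is [T]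
   times a unit because [2 b + s] is a unit, so [l] divides [1 - (1 + T)^s],
   whose coefficient of index [s] is [- 1].  Hence the translates of [S] by the
   multiples of [l e_j] are pairwise disjoint, so [S] has measure zero. *)

Require Import Defs.
From mathcomp Require Import all_boot all_order all_algebra ring.
From mathcomp Require Import all_classical all_reals all_analysis.

Set Implicit Arguments.
Unset Strict Implicit.
Unset Printing Implicit Defensive.

Import Order.TTheory GRing.Theory Num.Theory.
Local Open Scope ring_scope.

(** * Coefficients and units of formal power series *)

Lemma fps_coef_sum (R : comNzRingType) (I : Type) (r : seq I) (P : pred I)
    (F : I -> fps R) n :
  fps_coef (\sum_(i <- r | P i) F i) n = \sum_(i <- r | P i) fps_coef (F i) n.
Proof.
by elim/big_rec2: _ => [|i x y _ <-] //=; rewrite coef0.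
Qed.

Lemma fps_coef1 (R : comNzRingType) n :
  fps_coef (1 : fps R) n = (n == 0%N)%:R.
Proof. by rewrite /= coef1. Qed.

Lemma fps_coefB (R : comNzRingType) (f g : fps R) n :
  fps_coef (f - g) n = fps_coef f n - fps_coef g n.
Proof. by []. Qed.

Lemma fps_coefM (R : comNzRingType) (f g : fps R) n :
  fps_coef (f * g) n = \sum_(i < n.+1) fps_coef f i * fps_coef g (n - i)%N.
Proof. by []. Qed.

Lemma fps_coef_natM (R : comNzRingType) k (f : fps R) n :
  fps_coef (k%:R * f) n = k%:R * fps_coef f n.
Proof.
elim: k => [|k IHk]; first by rewrite !mul0r /= coef0.
by rewrite -!natr1 !mulrDl !mul1r -IHk.
Qed.

(** With zero constant term, [h ^+ k] is a multiple of T^k; this makes a geometric series in [h]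
    finite in each coefficient. *)
Lemma fps_coef_expr_eq0 (R : comNzRingType) (h : fps R) k n :
  fps_coef h 0 = 0 -> (n < k)%N -> fps_coef (h ^+ k) n = 0.
Proof.
move=> h0; elim: k n => // k IHk n nk; rewrite exprS fps_coefM.
apply: big1 => -[[|i] /= i_n] _; first by rewrite h0 mul0r.
rewrite IHk ?mulr0// -ltnS (leq_trans _ nk)// ltnS subnS prednK ?subn_gt0//.
exact: leq_subr.
Qed.

(* The inverse of [1 - h] is the geometric series, of which only the terms up
   to [h ^+ n] contribute to the coefficient of index [n]. *)
Lemma fps_is_unit_coef0 (R : comNzRingType) (f : fps R) (w : R) :
  fps_coef f 0 * w = 1 -> fps_is_unit f.
Proof.
move=> fw.
pose h : fps R := Fps (fun n => (n == 0%N)%:R - w * fps_coef f n).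
have h0 : fps_coef h 0 = 0 by rewrite /= mulrC fw subrr.
pose s n := \sum_(k < n.+1) h ^+ k.
have sE n i : (i <= n)%N -> fps_coef (s n) i = fps_coef (s i) i.
  elim: n => [|n IHn]; first by rewrite leqn0 => /eqP ->.
  rewrite leq_eqVlt ltnS => /predU1P[->//|i_n].
  rewrite /s big_ord_recr/= -/(s n) -/(h ^+ n.+1).
  by rewrite fps_coef_expr_eq0 ?ltnS// addr0 IHn.
have hM g n : fps_coef (f * Fps (fun i => w * fps_coef g i)) n =
              fps_coef ((1 - h) * g) n.
  apply: eq_bigr => i _ /=.
  by rewrite coef1 opprB addrCA subrr addr0 mulrCA mulrA.
exists (Fps (fun n => w * fps_coef (s n) n)); apply: fps_ext => n.
transitivity (fps_coef (f * Fps (fun i => w * fps_coef (s n) i)) n).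
  rewrite !fps_coefM; apply: eq_bigr => i _ /=.
  by rewrite (sE n (n - i)%N)// leq_subr.
rewrite hM; have -> : (1 - h) * s n = 1 - h ^+ n.+1.
  by rewrite -opprB mulNr -subrX1 opprB.
by rewrite /= fps_coef_expr_eq0// oppr0 addr0.
Qed.

(** * Residues, divisibility by [l], completeness and units in the l-adic integers *)

Section PadicArithmetic.
Variable l : nat.
Hypothesis l_pr : prime l.
Implicit Types x y z : padic l.

Let l_gt1 n : (1 < l ^ n.+1)%N.
Proof. by rewrite -{1}(expn0 l) ltn_exp2l ?prime_gt1. Qed.

Lemma padic_resM n x y :
  padic_res (x * y) n = padic_res x n * padic_res y n.
Proof. by []. Qed.

Lemma padic_resB n x y :
  padic_res (x - y) n = padic_res x n - padic_res y n.
Proof. by []. Qed.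

Lemma padic_resD n x y :
  padic_res (x + y) n = padic_res x n + padic_res y n.
Proof. by []. Qed.

Lemma padic_res_nat n k : padic_res (k%:R : padic l) n = k%:R.
Proof. by elim: k => // k IHk; rewrite -!natr1 -IHk. Qed.

Lemma padic_neq0_res x : x <> 0 -> exists k, padic_res x k <> 0.
Proof.
move=> x0; apply: contrapT => /forallNP xk; apply: x0; apply: padic_ext => k.
by apply: contrapT => /xk.
Qed.

Lemma padic_res_sum n (I : Type) (r : seq I) (P : pred I) (F : I -> padic l) :
  padic_res (\sum_(i <- r | P i) F i) n =
  \sum_(i <- r | P i) padic_res (F i) n.
Proof. by elim/big_rec2: _ => [|i x y _ <-]. Qed.

Lemma padic_res_prod n (I : Type) (r : seq I) (P : pred I) (F : I -> padic l) :
  padic_res (\prod_(i <- r | P i) F i) n =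
  \prod_(i <- r | P i) padic_res (F i) n.
Proof. by elim/big_rec2: _ => [|i x y _ <-]. Qed.

Lemma natr_Zp_eq0 n k : (k%:R == 0 :> 'Z_(l ^ n.+1)) = (l ^ n.+1 %| k)%N.
Proof. by rewrite -val_eqE /= val_Zp_nat. Qed.

Lemma natr_l_Zp : l%:R = 0 :> 'Z_(l ^ 1).
Proof. by apply/eqP; rewrite natr_Zp_eq0 expn1. Qed.

Lemma padic_res_natE x n : exists k : nat, padic_res x n = k%:R.
Proof. by exists (padic_res x n); rewrite natr_Zp. Qed.

Lemma padic_res_natS x n k :
  padic_res x n.+1 = k%:R -> padic_res x n = k%:R.
Proof.
rewrite -(padic_compat x n) => ->; apply/val_inj => /=.
by rewrite !val_Zp_nat// Zp_cast// modn_dvdm// dvdn_exp2l.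
Qed.

Lemma padic_res_nat_le x m n k : (n <= m)%N ->
  padic_res x m = k%:R -> padic_res x n = k%:R.
Proof.
elim: m => [|m IHm]; first by rewrite leqn0 => /eqP ->.
rewrite leq_eqVlt => /predU1P[-> //|n_m /padic_res_natS]; exact: IHm.
Qed.

Lemma padic_res_eq_le x y m n : (n <= m)%N ->
  padic_res x m = padic_res y m -> padic_res x n = padic_res y n.
Proof.
move=> n_m xy; have [k yk] := padic_res_natE y m.
by rewrite (padic_res_nat_le n_m yk) (@padic_res_nat_le x m n k)// xy.
Qed.

(** Multiplication by [l] gains exactly one digit: l^(n+2) divides l k if and only if l^(n+1)
    divides k. *)
Lemma padic_res_mull_eq0 x n :
  padic_res (l%:R * x) n.+1 = 0 <-> padic_res x n = 0.
Proof.
have [k xk] := padic_res_natE x n.+1.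
rewrite padic_resM (padic_res_natS xk) xk padic_res_nat -natrM.
have E : ((l * k)%:R == 0 :> 'Z_(l ^ n.+2)) = (k%:R == 0 :> 'Z_(l ^ n.+1)).
  by rewrite !natr_Zp_eq0 [(l ^ n.+2)%N]expnS dvdn_pmul2l ?prime_gt0.
by split=> /eqP kl; apply/eqP; move: kl; rewrite E.
Qed.

Lemma padic_res_mull_eq x y n :
  padic_res x n = padic_res y n ->
  padic_res (l%:R * x) n.+1 = padic_res (l%:R * y) n.+1.
Proof.
move=> xy; apply/eqP; rewrite -subr_eq0 -padic_resB -mulrBr.
by apply/eqP/padic_res_mull_eq0; rewrite padic_resB xy subrr.
Qed.

Lemma padic_dvdP x : padic_dvd x <-> padic_res x 0 = 0.
Proof.
split=> [[y ->]|x0].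
  by rewrite padic_resM padic_res_nat natr_l_Zp mul0r.
have l_gt0 := prime_gt0 l_pr.
(* Division by [l] loses one digit, so the quotient modulo l^(n+1) is read off from [x] modulo
   l^(n+2). *)
pose q n : nat := (padic_res x n.+1 %/ l)%N.
have q_compat n : inZp (nat_of_ord ((q n.+1)%:R : 'Z_(l ^ n.+2))) =
    (q n)%:R :> 'Z_(l ^ n.+1).
  apply/val_inj => /=; rewrite !val_Zp_nat// Zp_cast//.
  rewrite modn_dvdm ?dvdn_exp2l// /q -(padic_compat x n.+1) /=.
  move: (nat_of_ord (padic_res x n.+2)) => a; rewrite Zp_cast//.
  rewrite [(l ^ n.+2)%N]expnSr [in LHS](divn_eq a (l ^ n.+1 * l)).
  by rewrite mulnA divnMDl// modnMDl.
exists (Padic q_compat); apply: padic_ext => n.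
rewrite padic_resM /= padic_res_nat -natrM.
apply: padic_res_natS; rewrite -[LHS]natr_Zp; congr (_%:R).
rewrite mulnC divnK//; set k : nat := padic_res x n.+1.
have : padic_res x 0 = k%:R.
  by apply: (@padic_res_nat_le _ n.+1) => //; rewrite natr_Zp.
by rewrite x0 => /esym/eqP; rewrite natr_Zp_eq0.
Qed.

Lemma padic_res_eq0P x n :
  padic_res x n = 0 <-> exists y, x = l%:R ^+ n.+1 * y.
Proof.
elim: n x => [|n IHn] x.
  by rewrite expr1; exact: iff_sym (padic_dvdP x).
split=> [xn|[y ->]].
  have /padic_dvdP[y xy] : padic_res x 0 = 0.
    by rewrite (@padic_res_nat_le x n.+1 0 0).
  move: xn; rewrite xy => /padic_res_mull_eq0/IHn[z ->].
  by exists z; rewrite mulrA -exprS.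
by rewrite exprS -mulrA; apply/padic_res_mull_eq0/IHn; exists y.
Qed.

(** Cancelling [m] loses as many digits as the l-adic valuation of [m], which is less than [m]; the
    crude bound [m] suffices. *)
Lemma padic_res_mulnat_eq0 x m k n : (0 < m)%N -> (m + k <= n)%N ->
  padic_res (m%:R * x) n = 0 -> padic_res x k = 0.
Proof.
move=> m_gt0 mkn; have [a xa] := padic_res_natE x n.
rewrite padic_resM xa padic_res_nat -natrM => /eqP; rewrite natr_Zp_eq0.
rewrite (@padic_res_nat_le x n k a)//; last first.
  exact: leq_trans (leq_addl _ _) mkn.
case: (posnP a) => [->//|a_gt0].
rewrite pfactor_dvdn ?muln_gt0 ?m_gt0// lognM// => nma.
apply/eqP; rewrite natr_Zp_eq0 pfactor_dvdn// -(leq_add2l (logn l m)).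
apply: leq_trans nma; rewrite addnS ltnS (leq_trans _ mkn)// leq_add2r.
exact/ltnW/ltn_logl.
Qed.

(* A map that improves congruences modulo [l ^ n] to congruences modulo
   [l ^ n.+1] has a fixed point, by completeness. *)
Lemma padic_contraction (I : Type) (Phi : (I -> padic l) -> I -> padic l) :
  (forall u v, forall i, padic_res (Phi u i) 0 = padic_res (Phi v i) 0) ->
  (forall n u v, (forall i, padic_res (u i) n = padic_res (v i) n) ->
    forall i, padic_res (Phi u i) n.+1 = padic_res (Phi v i) n.+1) ->
  exists v, Phi v =1 v.
Proof.
move=> Phi0 PhiS; pose s n := iter n.+1 Phi (fun=> 0).
have sS n i : padic_res (s n.+1 i) n = padic_res (s n i) n.
  elim: n i => [|n IHn] i; first exact: Phi0.
  by apply: PhiS => j; exact: IHn.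
(* By [sS] the residue of index [n] no longer changes after [s n], so these residues define the
   limit. *)
have lim_compat i n :
    inZp (nat_of_ord (padic_res (s n.+1 i) n.+1)) = padic_res (s n i) n.
  by rewrite padic_compat.
pose v i := Padic (lim_compat i); exists v => i; apply: padic_ext => n.
rewrite -[RHS]/(padic_res (s n i) n); case: n => [|n]; first exact: Phi0.
by apply: PhiS => j.
Qed.

Lemma padic_unit x : padic_res x 0 <> 0 -> exists y, x * y = 1.
Proof.
have [a xa] := padic_res_natE x 0; rewrite xa => /eqP.
rewrite natr_Zp_eq0 expn1.
rewrite -prime_coprime// => la.
have [b xb] : exists b : nat, padic_res (x * b%:R) 0 = 1.
  exists ((a%:R : 'Z_(l ^ 1))^-1); rewrite padic_resM padic_res_nat natr_Zp xa.
  by rewrite divrr// unitZpE ?expn1 ?prime_gt1.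
have /padic_dvdP[z xbz] : padic_res (1 - x * b%:R) 0 = 0.
  by rewrite padic_resB xb subrr.
(* As x b = 1 - l z, the inverse of [x] is [b] times the inverse of 1 - l z, which is the fixed
   point of u -> 1 + l z u. *)
case: (@padic_contraction unit (fun u _ => 1 + l%:R * (z * u tt))).
- move=> u v _; rewrite !(padic_resD, padic_resM) padic_res_nat.
  by rewrite natr_l_Zp !mul0r.
- move=> n u v uv i; rewrite !(padic_resD n.+1).
  congr (_ + _); apply: padic_res_mull_eq.
  by rewrite !padic_resM uv.
move=> y /(_ tt) yE; exists (b%:R * y tt); apply/eqP; move: yE => /eqP.
rewrite mulrA -xbz mulrBl mul1r addrCA -subr_eq0 addrAC subrr add0r subr_eq0.
by rewrite eq_sym mulrA.
Qed.

End PadicArithmetic.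

(** * Binomial coefficients of l-adic integers and powers of 1 + T *)

Section PadicBinomial.
Variable l : nat.
Hypothesis l_pr : prime l.
Implicit Types b c x : padic l.

(** Here l^(m+1) divides [x]; the l-part of [m] divides l^(m+1), and the cofactor [w] prime to [l]
    is invertible. *)
Lemma padic_res_dvd_nat x m : (0 < m)%N ->
  padic_res x m = 0 -> exists y, x = m%:R * y.
Proof.
move=> m_gt0 /padic_res_eq0P-/(_ l_pr)[y ->].
have [w lw mE] := pfactor_coprime l_pr m_gt0.
have [v wv] : exists v, w%:R * v = 1 :> padic l.
  apply: padic_unit => //; rewrite padic_res_nat => /eqP.
  by rewrite natr_Zp_eq0// expn1 => lw'; rewrite prime_coprime// lw' in lw.
have vm : (logn l m <= m.+1)%N by rewrite ltnW// ltnS ltnW// ltn_logl.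
exists (v * l%:R ^+ (m.+1 - logn l m) * y).
have -> : m%:R = w%:R * l%:R ^+ logn l m :> padic l.
  by rewrite {1}mE natrM natrX.
rewrite -{1}(subnKC vm) exprD -[v * _ * y]mulrA mulrACA wv mul1r.
by rewrite mulrA.
Qed.

Lemma prod_subr_natr (N n : nat) :
  \prod_(i < n) (N%:R - i%:R) = (n`! * 'C(N, n))%:R :> padic l.
Proof.
rewrite mulnC bin_ffact ffact_prod natr_prod.
have [n_N|N_n] := leqP n N.
  by apply: eq_bigr => i _; rewrite natrB// ltnW// (leq_trans _ n_N).
rewrite (bigD1 (Ordinal N_n))//= [RHS](bigD1 (Ordinal N_n))//=.
by rewrite subrr subnn !mul0r.
Qed.

(** The quotient exists: for a natural number [N] close enough to [b], the products for [b] and [N]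
    differ by a multiple of n!, and the product for [N] is n! times an ordinary binomial
    coefficient. *)
Lemma padic_binomE b n :
  n`!%:R * padic_binom b n = \prod_(i < n) (b - i%:R).
Proof.
apply: (@xgetPex _ 0 [set c | n`!%:R * c = \prod_(i < n) (b - i%:R)]).
have [N bN] := padic_res_natE b n`!.
have [|y yE] := @padic_res_dvd_nat
  (\prod_(i < n) (b - i%:R) - \prod_(i < n) (N%:R - i%:R)) n`! (fact_gt0 n).
  rewrite padic_resB !padic_res_prod (eq_bigr _ (fun i _ => padic_resB _ _ _)).
  rewrite [X in _ - X](eq_bigr _ (fun i _ => padic_resB _ _ _)).
  by rewrite bN padic_res_nat subrr.
exists (y + 'C(N, n)%:R); rewrite /= mulrDr -yE -natrM -prod_subr_natr.
by rewrite subrK.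
Qed.

(** An explicit form of continuity in [b]: it reduces identities between binomial coefficients to
    natural numbers, which are dense. *)
Lemma padic_res_binom b n k K N : (n`! + k <= K)%N ->
  padic_res b K = N%:R -> padic_res (padic_binom b n) k = 'C(N, n)%:R.
Proof.
move=> nkK bN; apply/eqP; rewrite -subr_eq0 -(padic_res_nat l k) -padic_resB.
apply/eqP/(padic_res_mulnat_eq0 l_pr (fact_gt0 n) nkK).
rewrite mulrBr padic_binomE -natrM -prod_subr_natr.
rewrite padic_resB !padic_res_prod (eq_bigr _ (fun i _ => padic_resB _ _ _)).
rewrite [X in _ - X](eq_bigr _ (fun i _ => padic_resB _ _ _)).
by rewrite bN padic_res_nat subrr.
Qed.

Lemma onePT_pow_nat (N : nat) n :
  fps_coef (onePT_pow (N%:R : padic l)) n = 'C(N, n)%:R.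
Proof.
apply: padic_ext => k; rewrite padic_res_nat.
by apply: (@padic_res_binom _ _ _ (n`! + k)) => //; rewrite padic_res_nat.
Qed.

(** Modulo each power of [l] this is Vandermonde's identity for natural numbers approximating [b]
    and [c]. *)
Lemma onePT_powD b c : onePT_pow (b + c) = onePT_pow b * onePT_pow c.
Proof.
apply: fps_ext => n; apply: padic_ext => k.
have [N bN] := padic_res_natE b (n`! + k).
have [M cM] := padic_res_natE c (n`! + k).
rewrite (@padic_res_binom _ _ _ (n`! + k) (N + M))//; last first.
  by rewrite padic_resD bN cM natrD.
rewrite fps_coefM padic_res_sum -binomial.Vandermonde natr_sum.
apply: eq_bigr => i _; rewrite natrM padic_resM.
have i_n : (i <= n)%N by rewrite -ltnS.
rewrite (@padic_res_binom b i k (n`! + k) N) ?leq_add2r ?leq_fact//.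
rewrite (@padic_res_binom c (n - i) k (n`! + k) M)// leq_add2r leq_fact//.
exact: leq_subr.
Qed.

Lemma onePT_pow_coef0 b : fps_coef (onePT_pow b) 0 = 1.
Proof. by have := padic_binomE b 0; rewrite big_ord0 mul1r. Qed.

Lemma onePT_pow_coef1 b : fps_coef (onePT_pow b) 1 = b.
Proof. by have := padic_binomE b 1; rewrite big_ord1 mul1r subr0. Qed.

End PadicBinomial.

(** * Weierstrass preparation and the positivity of mu *)

Section Weierstrass.
Variable l : nat.
Hypothesis l_pr : prime l.
Implicit Types (f g u : fps (padic l)) (x : padic l).

Lemma fps_dvdMr f g :
  (forall n, padic_dvd (fps_coef f n)) ->
  forall n, padic_dvd (fps_coef (f * g) n).
Proof.
move=> fl n; apply/padic_dvdP => //; rewrite fps_coefM padic_res_sum.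
by apply: big1 => i _; rewrite padic_resM (padic_dvdP l_pr _).1// mul0r.
Qed.

(** As [g] is T times a unit, strong induction applies: once the lower coefficients of [f] vanish
    modulo [l], the coefficient of index n + 1 of [f * g] is congruent to f_n g_1. *)
Lemma fps_dvd_cancel f g x :
  fps_coef g 0 = 0 -> fps_coef g 1 * x = 1 ->
  (forall n, padic_dvd (fps_coef (f * g) n)) ->
  forall n, padic_dvd (fps_coef f n).
Proof.
move=> g0 g1 fgl; elim/ltn_ind => n IHn; apply/padic_dvdP => //.
have /(padic_dvdP l_pr) := fgl n.+1.
rewrite fps_coefM 2!big_ord_recr /= subnn g0 mulr0 addr0 subSnn.
rewrite padic_res_sum big1 => [|i _]; last first.
  by rewrite padic_resM (padic_dvdP l_pr _).1 ?mul0r//; exact: IHn.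
rewrite add0r => /(congr1 (fun y => y * padic_res x 0)).
by rewrite mul0r -mulrA -padic_resM g1 mulr1.
Qed.

Lemma padic_not_dvd1 : ~ padic_dvd (1 : padic l).
Proof. by move/padic_dvdP => /(_ l_pr)/eqP; rewrite (negbTE (oner_neq0 _)). Qed.

(* Let [d] be the least index of a coefficient not divisible by [l], and write
   [f = P + T^d U] with [P] of degree less than [d].  The shift by [d] of [f v]
   is [1] if and only if [v = U^-1 (1 - shift (P v))], whose right-hand side is
   a contraction in [v] as [l] divides [P]. *)
Lemma weierstrass_preparation f : (exists n, ~ padic_dvd (fps_coef f n)) ->
  exists (g : {poly padic l}) u, weierstrass f 0 g u.
Proof.
move=> [n0 fn0]; have ex_d : exists i, padic_res (fps_coef f i) 0 != 0.
  by exists n0; apply/eqP => /(padic_dvdP l_pr).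
case: (ex_minnP ex_d) => d /eqP fd min_d.
have f_low i : (i < d)%N -> padic_dvd (fps_coef f i).
  move=> i_d; apply/padic_dvdP => //.
  by apply: contraTeq i_d => /min_d; rewrite -leqNgt.
pose U : fps (padic l) := Fps (fun n => fps_coef f (n + d)).
have [w Uw] : exists w, fps_coef U 0 * w = 1.
  exact: padic_unit.
have [V UV] := fps_is_unit_coef0 Uw.
have [q fq] : exists q : nat -> padic l,
    forall i, (i < d)%N -> fps_coef f i = l%:R * q i.
  have ex i : exists y, (i < d)%N -> fps_coef f i = l%:R * y.
    have [i_d|d_i] := ltnP i d; last by exists 0.
    by have [y fy] := f_low _ i_d; exists y.
  by exists (fun i => projT1 (cid (ex i))) => i; exact: projT2 (cid (ex i)).
pose L (v : nat -> padic l) n := \sum_(i < d) fps_coef f i * v (n + d - i)%N.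
have L0 v n : padic_res (L v n) 0 = 0.
  rewrite padic_res_sum big1// => i _.
  by rewrite padic_resM ((padic_dvdP l_pr _).1 (f_low _ (ltn_ord i))) mul0r.
have LS k v v' : (forall n, padic_res (v n) k = padic_res (v' n) k) ->
    forall n, padic_res (L v n) k.+1 = padic_res (L v' n) k.+1.
  move=> vv' n; rewrite !padic_res_sum; apply: eq_bigr => i _.
  rewrite fq// -!mulrA; apply: padic_res_mull_eq => //.
  by rewrite !padic_resM vv'.
pose Phi v n := fps_coef (V * (1 - Fps (L v))) n.
have Phi_eq k v v' : (forall n, padic_res (L v n) k = padic_res (L v' n) k) ->
    forall n, padic_res (Phi v n) k = padic_res (Phi v' n) k.
  move=> vv' n; rewrite /Phi !fps_coefM !padic_res_sum; apply: eq_bigr => i _.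
  by rewrite !(padic_resM, padic_resB) vv'.
case: (padic_contraction (Phi := Phi)).
- by move=> v v'; apply: Phi_eq => n; rewrite !L0.
- by move=> k v v' /LS vv'; apply: Phi_eq.
move=> v0 Phiv; pose v := Fps v0.
have Uv : U * v = 1 - Fps (L v0).
  have -> : v = V * (1 - Fps (L v0)) by apply: fps_ext => n; exact/esym/Phiv.
  by rewrite mulrA UV mul1r.
(* The coefficients of [f] below [d] contribute [L v0], the others [U * v]; the two add up to 1. *)
have fvd n : fps_coef (f * v) (n + d) = (n == 0%N)%:R.
  rewrite fps_coefM -addSn addnC big_split_ord /= -[X in X + _]/(L v0 n).
  have -> : \sum_(i < n.+1) fps_coef f (d + i) * v0 (n + d - (d + i))%N =
            fps_coef (U * v) n.
    rewrite fps_coefM; apply: eq_bigr => i _ /=.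
    by rewrite [(d + i)%N]addnC subnDr.
  by rewrite Uv /= coef1 addrCA subrr addr0.
(* Modulo [l] the term [L v0] vanishes, so the constant term of [U * v] is 1 and that of [v] is a
   unit. *)
have [v' vv'] : fps_is_unit v.
  have [|w' vw'] := @padic_unit l l_pr (fps_coef v 0).
    move=> v00; have : padic_res (fps_coef (U * v) 0) 0 = 0.
      by rewrite fps_coefM big_ord1 padic_resM v00 mulr0.
    rewrite Uv padic_resB L0 subr0 fps_coef1 => /eqP.
    by rewrite (negbTE (oner_neq0 _)).
  exact: fps_is_unit_coef0 vw'.
have ge_d n : (d <= n)%N -> fps_coef (f * v) n = (n == d)%:R.
  by move=> d_n; rewrite -{1}(subnK d_n) fvd subn_eq0 eqn_leq d_n andbT.
(* No coefficient of [f * v] above index [d] survives, so this truncation is exact. *)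
pose g := \poly_(i < d.+1) fps_coef (f * v) i.
have gd : g`_d = 1 by rewrite coef_poly ltnSn ge_d// eqxx.
have sz_g : size g = d.+1.
  by rewrite size_poly_eq// ge_d// eqxx oner_neq0.
have gE : fps_of_poly g = f * v.
  apply: fps_ext => n /=; rewrite coef_poly ltnS; case: leqP => // d_n.
  by rewrite [RHS](ge_d _ (ltnW d_n)) gtn_eqF.
exists g, v'; split.
- split; first by rewrite monicE lead_coefE sz_g gd.
  move=> i; rewrite sz_g /= => i_d; rewrite coef_poly ltnS ltnW//.
  apply/padic_dvdP => //; rewrite fps_coefM padic_res_sum.
  apply: big1 => j _; have j_d : (j < d)%N.
    by apply: leq_ltn_trans i_d; rewrite -ltnS.
  by rewrite padic_resM ((padic_dvdP l_pr _).1 (f_low _ j_d)) mul0r.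
- by exists v; rewrite mulrC.
- by rewrite expr0 mul1r gE -mulrA vv' mulr1.
Qed.

(** Factors [l] are removed until some coefficient is nonzero modulo [l]. The induction is on an
    index [k] at which a fixed coefficient has nonzero residue; each division by [l] lowers it by
    one. *)
Lemma weierstrass_exists f : (exists n, fps_coef f n <> 0) ->
  exists mu (g : {poly padic l}) u, weierstrass f mu g u.
Proof.
move=> [n fn]; have [k] := padic_neq0_res fn.
elim: k f {fn} => [|k IHk] f fnk; (have [fl|/existsNP nfl] :=
    pselect (forall i, padic_dvd (fps_coef f i)); last first).
- by exists 0%N; exact: weierstrass_preparation.
- by case: fnk; apply/padic_dvdP.
- by exists 0%N; exact: weierstrass_preparation.
have [h fh] := choice fl.
have fE : f = l%:R * Fps h by apply: fps_ext => i; rewrite fps_coef_natM fh.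
have [|mu [g [u [gd uu hE]]]] := IHk (Fps h).
  by move=> hk; apply: fnk; rewrite fh; apply/padic_res_mull_eq0.
by exists mu.+1, g, u; split=> //; rewrite fE hE exprS !mulrA.
Qed.

(** This replaces the chosen exponent by conditions on coefficients, from which measurability can be
    read off. *)
Lemma mu_fps_gt0P f : (0 < mu_fps f)%N <->
  (forall n, padic_dvd (fps_coef f n)) /\ (exists n, fps_coef f n <> 0).
Proof.
have lead1 (g : {poly padic l}) : distinguished g ->
    fps_coef (fps_of_poly g) (size g).-1 = 1.
  by move=> [/monicP g1 _]; rewrite -g1 lead_coefE.
split=> [|[fl f0]].
  (* The default value of [xget] is 0, so a positive exponent comes from an actual factorization. *)
  rewrite /mu_fps; case: xgetP => // mu _ [g [u [gd [w uw] fE]]] mu_gt0.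
  split=> [n|].
    rewrite fE -(prednK mu_gt0) exprS -!mulrA fps_coef_natM.
    by exists (fps_coef (l%:R ^+ mu.-1 * (fps_of_poly g * u)) n).
  apply: contrapT => /forallNP f0.
  (* If [f] were 0, the leading coefficient l^mu of the left side would vanish modulo l^(mu+1). *)
  have /(congr1 (fun h => padic_res (fps_coef h (size g).-1) mu)) :
      l%:R ^+ mu * fps_of_poly g = f * w.
    by rewrite fE -[RHS]mulrA uw mulr1.
  have -> : f = 0.
    by apply: fps_ext => n; rewrite [RHS]coef0; apply: contrapT => /f0.
  rewrite mul0r -natrX fps_coef_natM lead1// mulr1 padic_res_nat /= coef0.
  move=> /eqP.
  by rewrite natr_Zp_eq0// dvdn_Pexp2l ?ltnn ?prime_gt1.
rewrite lt0n; apply/negP => /eqP mu0.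
have : exists (g : {poly padic l}) u, weierstrass f (mu_fps f) g u.
  exact: (@xgetPex _ 0%N
    [set mu | exists (g : {poly padic l}) u, weierstrass f mu g u])
    (weierstrass_exists f0).
rewrite mu0 => -[g [u [gd [w uw] fE]]].
(* With exponent 0, [l] would divide every coefficient of the monic polynomial [g]. *)
have gE : fps_of_poly g = f * w by rewrite fE expr0 mul1r -mulrA uw mulr1.
by apply: padic_not_dvd1; rewrite -(lead1 g)// gE; exact: fps_dvdMr.
Qed.

End Weierstrass.

(** * The effect on the series of shifting one voltage *)

Section BouquetShift.
Variables (l t : nat).
Hypothesis l_pr : prime l.
Hypothesis l_odd : odd l.
Implicit Types (alpha beta : 'rV[padic l]_t) (j : 'I_t).

Lemma bouquet_series_coef alpha n :
  fps_coef (bouquet_series alpha) n =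
  \sum_j
    (fps_coef 2 n - padic_binom (alpha 0 j) n - padic_binom (- alpha 0 j) n).
Proof. exact: fps_coef_sum. Qed.

(** Each coefficient modulo a power of [l] is locally constant in the voltages, hence conditions on
    it are open. *)
Lemma bouquet_series_res alpha beta n k :
  (forall j,
    padic_res (alpha 0 j) (n`! + k) = padic_res (beta 0 j) (n`! + k)) ->
  padic_res (fps_coef (bouquet_series alpha) n) k =
  padic_res (fps_coef (bouquet_series beta) n) k.
Proof.
have binom_res (b c : padic l) :
    padic_res b (n`! + k) = padic_res c (n`! + k) ->
    padic_res (padic_binom b n) k = padic_res (padic_binom c n) k.
  have [N bN] := padic_res_natE b (n`! + k); rewrite bN => /esym cN.
  by rewrite (padic_res_binom l_pr _ bN)// (padic_res_binom l_pr _ cN).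
move=> ab; rewrite !bouquet_series_coef !padic_res_sum.
apply: eq_bigr => j _; rewrite !padic_resB; congr (_ - _ - _).
  exact: binom_res.
by apply: binom_res; congr (- _); exact: ab.
Qed.

Lemma bouquet_series_shift alpha j (s : nat) :
  (0 < s)%N -> (l %| s)%N -> ~ padic_dvd (alpha 0 j) ->
  (forall n, padic_dvd (fps_coef (bouquet_series alpha) n)) ->
  (forall n, padic_dvd
    (fps_coef (bouquet_series (s%:R *: delta_mx 0 j + alpha)) n)) ->
  False.
Proof.
move=> s_gt0 ls bl fl f'l; set beta := _ + alpha in f'l.
pose b := alpha 0 j.
have beta_j : beta 0 j = b + s%:R by rewrite !mxE !eqxx mulr1 addrC.
have beta_i i : i != j -> beta 0 i = alpha 0 i.
  by move=> /negbTE ij; rewrite !mxE ij andbF mulr0 add0r.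
pose D := 1 - onePT_pow (s%:R : padic l).
pose E := onePT_pow b - onePT_pow (- (b + s%:R)).
have DE : bouquet_series beta - bouquet_series alpha = D * E.
  rewrite /bouquet_series (bigD1 j)//= [X in _ - X](bigD1 j)//= beta_j -/b.
  rewrite (eq_bigr (fun i =>
      2 - onePT_pow (alpha 0 i) - onePT_pow (- alpha 0 i)));
    last by move=> i ij; rewrite beta_i.
  set S := \sum_(i < t | _) _; rewrite /D /E.
  (* Writing (1 + T)^(-b) as (1 + T)^(-b-s) (1 + T)^s turns the factorization into a ring
     identity. *)
  have -> : onePT_pow (- b) = onePT_pow (- (b + s%:R)) * onePT_pow s%:R.
    by rewrite -onePT_powD// opprD subrK.
  by rewrite onePT_powD//; ring.
have E0 : fps_coef E 0 = 0 by rewrite fps_coefB !onePT_pow_coef0// subrr.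
(* The linear coefficient is 2 b + s, congruent to 2 b modulo [l]; it is a unit because [l] is odd
   and does not divide b. *)
have [w Ew] : exists w, fps_coef E 1 * w = 1.
  apply: padic_unit => //; rewrite fps_coefB !onePT_pow_coef1// opprK.
  have [a ba] := padic_res_natE b 0.
  rewrite !padic_resD ba padic_res_nat -!natrD => /eqP.
  rewrite natr_Zp_eq0// expn1 addnA dvdn_addl// addnn -mul2n => la2.
  apply/bl/padic_dvdP => //; rewrite -/b ba; apply/eqP.
  rewrite natr_Zp_eq0// expn1; move: la2; rewrite Gauss_dvdr//.
  by rewrite prime_coprime// gtnNdvd// odd_prime_gt2.
have DEl n : padic_dvd (fps_coef (D * E) n).
  apply/padic_dvdP => //.
  by rewrite -DE padic_resB !(padic_dvdP l_pr _).1// subrr.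
have /(padic_dvdP l_pr)/eqP := fps_dvd_cancel l_pr E0 Ew DEl s.
rewrite padic_resB fps_coef1 gtn_eqF// sub0r.
by rewrite onePT_pow_nat// binn oppr_eq0 (negbTE (oner_neq0 _)).
Qed.

End BouquetShift.

(** * Open and Borel sets of voltage vectors *)

Section PadicBorel.
Variables (l t : nat).
Implicit Types (alpha beta : 'rV[padic l]_t) (A : set 'rV[padic l]_t).
Local Open Scope classical_set_scope.

Lemma padic_nbhsP (x : padic l) (U : set (padic l)) :
  nbhs x U <-> exists n, forall y, padic_res y n = padic_res x n -> U y.
Proof.
split=> [[V [oV Vx VU]]|[n nU]].
  by have [n nV] := oV x Vx; exists n => y /nV/VU.
exists [set y | padic_res y n = padic_res x n]; split=> //.
by move=> y /= yx; exists n => z ->.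
Qed.

Hypothesis l_pr : prime l.

Lemma padic_row_openP A : open A <-> forall alpha, A alpha -> exists n,
  forall beta, (forall j, padic_res (beta 0 j) n = padic_res (alpha 0 j) n) ->
  A beta.
Proof.
rewrite openE.
split=> [oA alpha /oA [P alphaP PA]|oA alpha /oA[n nA]]; last first.
  exists (fun _ j => [set y | padic_res y n = padic_res (alpha 0 j) n]).
    by move=> i j; rewrite ord1; apply/padic_nbhsP; exists n.
  by move=> beta beta_alpha; apply: nA => j; exact: beta_alpha.
have /choice[n nP] : forall j, exists n, forall y,
    padic_res y n = padic_res (alpha 0 j) n -> P 0 j y.
  by move=> j; apply/padic_nbhsP; exact: alphaP.
(* The largest of the finitely many precisions serves all coordinates. *)
exists (\max_j n j)%N => beta beta_alpha; apply: PA => i j; rewrite (ord1 i).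
apply: nP; apply: (padic_res_eq_le l_pr) (beta_alpha j).
exact: leq_bigmax.
Qed.

Lemma measurable_padic_open A : open A ->
  measurable (A : set (padic_borel l t)).
Proof. exact: sub_sigma_algebra. Qed.

(** The translate by [a] is the preimage under subtraction of [a], and preimages of open sets under
    this map are open. *)
Lemma measurable_padic_translate (a : 'rV[padic l]_t) A :
  measurable (A : set (padic_borel l t)) ->
  measurable ([set a + x | x in A] : set (padic_borel l t)).
Proof.
pose f : padic_borel l t -> padic_borel l t := fun x : 'rV_t => x - a.
have mf : measurable_fun setT f.
  apply: (@measurability _ _ _ _ setT f (@open 'rV[padic l]_t)) => //.
  move=> _ [B oB <-].
  rewrite setTI; apply: measurable_padic_open; apply/padic_row_openP => alpha.
  move=> /((padic_row_openP B).1 oB)[n nB]; exists n => beta beta_alpha.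
  by apply: nB => j; rewrite !mxE !padic_resB beta_alpha.
move=> mA; have := mf measurableT _ mA; rewrite setTI; congr measurable.
apply/seteqP; split=> [x Ax|x [y Ay <-]]; last by rewrite /f /= addrC addKr.
by exists (x - a) => //; rewrite addrC subrK.
Qed.

End PadicBorel.

(** If the common measure is r, then n disjoint sets give n r <= 1 for every n; a natural number
    above 1/r contradicts r > 0. *)
Lemma probability_disjoint_eq0 d (T : measurableType d) (R : realType)
    (P : probability T R) (F : nat -> set T) :
  (forall n, measurable (F n)) -> trivIset setT F ->
  (forall n, P (F n) = P (F 0%N)) -> P (F 0%N) = 0%E.
Proof.
move=> mF tF eqF; set r := fine (P (F 0%N)).
have PF : P (F 0%N) = r%:E by rewrite fineK// fin_num_measure.
have r_ge0 : 0 <= r by rewrite fine_ge0.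
have r_le1 n : r * n%:R <= 1.
  rewrite -lee_fin.
  have <- : P (\big[setU/set0]_(i < n) F i) = (r * n%:R)%:E.
    rewrite measure_semi_additive_ord_I//; last first.
    - exact: bigsetU_measurable.
    - exact: sub_trivIset tF.
    rewrite (eq_bigr (fun=> r%:E)); last first.
      by move=> i _; exact: etrans (eqF i) PF.
    by rewrite sumEFin sumr_const card_ord mulr_natr.
  exact/probability_le1/bigsetU_measurable.
rewrite PF; congr (_%:E); apply/eqP; rewrite eq_le r_ge0 andbT leNgt.
apply/negP => r_gt0; have := r_le1 (Num.bound r^-1).
apply/negP; rewrite -ltNge mulrC -ltr_pdivrMr// div1r.
by apply: le_lt_trans (archi_boundP _); rewrite ?invr_ge0.
Qed.

(** * Positive mu has probability zero *)

Section MuPositive.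
Variables (l t : nat).
Hypothesis l_pr : prime l.
Hypothesis l_odd : odd l.
Local Open Scope classical_set_scope.
Implicit Types alpha beta : 'rV[padic l]_t.

(** Admissible vectors are split according to a unit coordinate, since the shift argument moves one
    such coordinate. *)
Definition mu_pos_unit (j : 'I_t) : set 'rV[padic l]_t :=
  [set alpha : 'rV[padic l]_t |
    ~ padic_dvd (alpha 0 j) /\ (0 < mu_bouquet alpha)%N].

Lemma mu_pos_cover :
  [set alpha : 'rV[padic l]_t | admissible alpha /\ (0 < mu_bouquet alpha)%N] =
  \bigcup_(j in [set: 'I_t]) mu_pos_unit j.
Proof.
apply/seteqP; split=> alpha; first by move=> [[j aj] mu_gt0]; exists j.
by move=> [j _ [aj mu_gt0]]; split=> //; exists j.
Qed.

(** The set is the intersection of an open set (unit coordinate), a countable intersection of open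
    sets ([l] divides all coefficients) and an open set (nonzero series). *)
Lemma measurable_mu_pos_unit (j : 'I_t) :
  measurable (mu_pos_unit j : set (padic_borel l t)).
Proof.
have -> : mu_pos_unit j =
    [set alpha : 'rV[padic l]_t | ~ padic_dvd (alpha 0 j)] `&`
    ((\bigcap_n [set alpha : 'rV[padic l]_t |
       padic_dvd (fps_coef (bouquet_series alpha) n)]) `&`
    [set alpha : 'rV[padic l]_t |
       exists n, fps_coef (bouquet_series alpha) n <> 0]).
  apply/seteqP; split=> alpha [aj].
    by move=> /(mu_fps_gt0P l_pr)[fl f0]; split=> //; split=> // n _; exact: fl.
  move=> [fl f0]; split=> //; apply/(mu_fps_gt0P l_pr); split=> // n; exact: fl.
apply: (@measurableI _ (padic_borel l t));
  last apply: (@measurableI _ (padic_borel l t)).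
- apply: measurable_padic_open; apply/padic_row_openP => // alpha aj.
  exists 0%N => beta /(_ j) bj /padic_dvdP-/(_ l_pr); rewrite bj.
  by move/(padic_dvdP l_pr).
- apply: (@bigcapT_measurable _ (padic_borel l t)) => n.
  apply: measurable_padic_open; apply/padic_row_openP => // alpha.
  move=> /(padic_dvdP l_pr) fl; exists (n`! + 0)%N => beta ba.
  by apply/(padic_dvdP l_pr); rewrite (bouquet_series_res l_pr ba).
- apply: measurable_padic_open; apply/padic_row_openP => // alpha [n fn].
  have [k fk] := padic_neq0_res fn.
  exists (n`! + k)%N => beta ba; exists n => b0; apply: fk.
  by rewrite -(bouquet_series_res l_pr ba) b0.
Qed.

Lemma mu_pos_unit_null (R : realType) (tau : probability (padic_borel l t) R)
    (j : 'I_t) : is_haar tau -> tau (mu_pos_unit j) = 0%E.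
Proof.
move=> haar; have mS := measurable_mu_pos_unit j.
pose a n : 'rV[padic l]_t := (l * n)%:R *: delta_mx 0 j.
have := @probability_disjoint_eq0 _ _ _ tau
  (fun n => [set a n + x | x in mu_pos_unit j]).
rewrite !haar//; apply; last by move=> n; rewrite !haar.
  by move=> n; exact: measurable_padic_translate.
(* If the translates by [a m] and [a n] meet with m < n, then x is [y] shifted by the positive
   multiple l (n - m) of [l], which [bouquet_series_shift] excludes. *)
have disj m n x y : mu_pos_unit j x -> mu_pos_unit j y ->
    a m + x = a n + y -> (m < n)%N -> False.
  move=> [xj /(mu_fps_gt0P l_pr)[fx _]] [yj /(mu_fps_gt0P l_pr)[fy _]] xy mn.
  apply: (@bouquet_series_shift l t l_pr l_odd y j (l * (n - m))) => //.
  - by rewrite muln_gt0 prime_gt0// subn_gt0.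
  - exact: dvdn_mulr.
  suff <- : x = (l * (n - m))%:R *: delta_mx 0 j + y by [].
  apply: (addrI (a m)); rewrite xy addrA -scalerDl -natrD -mulnDr subnKC//.
  exact: ltnW.
move=> m n _ _ [_ [[x Sx <-] [y Sy /esym xy]]].
case: (ltngtP m n) => // [mn|nm]; first by case: (disj _ _ _ _ Sx Sy xy mn).
by case: (disj _ _ _ _ Sy Sx (esym xy) nm).
Qed.

Lemma Prob_mu_pos_eq0 (R : realType) (tau : probability (padic_borel l t) R) :
  is_haar tau -> Prob_mu_pos tau = 0%E.
Proof.
move=> haar; rewrite /Prob_mu_pos mu_pos_cover.
suff -> : tau (\bigcup_(j in [set: 'I_t]) mu_pos_unit j) = 0%E by rewrite mule0.
have mS j : [set: 'I_t] j -> measurable (mu_pos_unit j : set (padic_borel l t)).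
  by move=> _; exact: measurable_mu_pos_unit.
apply/eqP; rewrite eq_le measure_ge0 andbT.
have mU : measurable
    (\bigcup_(j in [set: 'I_t]) mu_pos_unit j : set (padic_borel l t)).
  exact: fin_bigcup_measurable.
(* Finite subadditivity over the [t] coordinates. *)
have := content_sub_fsum tau finite_finset mS mU (@subset_refl _ _).
by rewrite fsbig1// => j _; exact: mu_pos_unit_null.
Qed.

End MuPositive.

(* The entries of a tuple of naturals with sum i are at most i, so such tuples
   are the functions a : 'I_m -> 'I_i.+1 with sum i, where m = (l - 1) / 2 *)
Theorem theorem4p6 (R : realType) (l t : nat)
    (tau : probability (padic_borel l t) R) :
  prime l -> odd l -> (2 <= t)%N -> is_haar tau ->
  (Prob_mu_pos tau <=
    (\sum_(1 <= i < (t %/ l).+1)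
       2 ^+ (i * l) * 'C(t, i * l)%:R *
       \sum_(a : {ffun 'I_((l - 1) %/ 2) -> 'I_i.+1}
               | (\sum_j (a j : nat))%N == i)
         ((i * l)`!%:R /
          ((l%:R ^+ t - 1) * \prod_j (a j * l)`!%:R)))%:E)%E.
Proof.
(* The left side is 0, and each term on the right is nonnegative because l^t >= 1. *)
move=> l_pr l_odd _ haar; rewrite Prob_mu_pos_eq0// lee_fin.
apply: sumr_ge0 => i _; rewrite mulr_ge0 ?mulr_ge0 ?exprn_ge0//.
apply: sumr_ge0 => a _; rewrite divr_ge0// mulr_ge0 ?prodr_ge0//.
by rewrite subr_ge0 exprn_ege1// ler1n prime_gt0.
Qed.
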